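(* Let $(X,d)$ be a metric space, $\mu\colon X^3\to X$ a ternary operation and $n\in\mathbb N$. Then $(X,d,\mu)$ is a coarse median space of rank at most $n$ if and only if the following hold: (M1) $\mu(a,a,b)=a$ for all $a,b\in X$; (M2) $\mu(a_{\sigma(1)},a_{\sigma(2)},a_{\sigma(3)})=\mu(a_1,a_2,a_3)$ for all $a_1,a_2,a_3\in X$ and all permutations $\sigma$; (C1)' there is an affine function $\rho\colon[0,\infty)\to[0,\infty)$ with $d(\mu(a,b,c),\mu(a',b,c))\leqslant\rho(d(a,a'))$ for all $a,a',b,c\in X$; (C2)' there is a constant $\kappa_4>0$ with $\mu(\mu(a,b,c),b,d)\sim_{\kappa_4}\mu(a,b,\mu(c,b,d))$ for all $a,b,c,d\in X$; (C3)' for every $\lambda>0$ there is $C=C(\lambda)$ such that for all $a,b\in X$ and all $e_1,\ldots,e_{n+1}\in[a,b]$ with $\mu(e_i,a,e_j)\sim_\lambda a$ for all $i\neq j$, there exists $i$ with $e_i\sim_C a$.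
   Context: Write $x\sim_s y$ if $d(x,y)\leqslant s$. A coarse median space is a triple $(X,d,\mu)$ with $(X,d)$ a metric space and $\mu\colon X^3\to X$ satisfying: (M1) $\mu(a,a,b)=a$; (M2) $\mu(a_1,a_2,a_3)$ is invariant under permutations of its arguments; (C1) there is an affine $\rho(t)=Kt+H_0$ with $d(\mu(a,b,c),\mu(a',b',c'))\leqslant\rho(d(a,a')+d(b,b')+d(c,c'))$ for all points; (C2) there is $H\colon\mathbb N\to[0,\infty)$ such that for every finite $A\subseteq X$ with $1\leqslant|A|\leqslant p$ there are a finite median algebra $(\Pi,\mu_\Pi)$ and maps $\pi\colon A\to\Pi$, $\lambda\colon\Pi\to X$ with $\lambda\mu_\Pi(x,y,z)\sim_{H(p)}\mu(\lambda x,\lambda y,\lambda z)$ for all $x,y,z\in\Pi$ and $\lambda\pi a\sim_{H(p)}a$ for all $a\in A$. (A median algebra is a set with a ternary operation $m$ satisfying $m(a,a,b)=a$, full symmetry, and $m(m(a,b,c),b,d)=m(a,b,m(c,b,d))$.) The rank of a median algebra is the supremum of $k$ such that it contains a subalgebra isomorphic to $I^k=(\mathbb Z_2)^k$ with coordinatewise majority vote as median. The coarse median space has rank at most $n$ if there exist $\rho,H$ as in (C1),(C2) for which $\Pi$ in (C2) can always be chosen of rank at most $n$. The interval is $[a,b]=\{\mu(a,y,b):y\in X\}$. *)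

(* Defs.v *)
From mathcomp Require Import all_boot all_order all_algebra all_fingroup.
From mathcomp Require Import reals.
Set Implicit Arguments. Unset Strict Implicit. Unset Printing Implicit Defensive.
Import Order.TTheory GRing.Theory Num.Theory.
Local Open Scope ring_scope.

Definition is_metric (R : realType) (X : Type) (d : X -> X -> R) : Prop :=
  (forall x y, 0 <= d x y) /\ (forall x y, d x y = 0 <-> x = y) /\
  (forall x y, d x y = d y x) /\ (forall x y z, d x z <= d x y + d y z).

Definition simr (R : realType) (X : Type) (d : X -> X -> R) (s : R) (x y : X) : Prop :=
  d x y <= s.

Definition sym3 (T : Type) (m : T -> T -> T -> T) : Prop :=
  forall (s : 'S_3) (a : 'I_3 -> T),
    m (a (s ord0)) (a (s (inord 1))) (a (s (inord 2))) = m (a ord0) (a (inord 1)) (a (inord 2)).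

Definition is_median_algebra (T : Type) (m : T -> T -> T -> T) : Prop :=
  (forall a b, m a a b = a) /\ sym3 m /\
  (forall a b c d, m (m a b c) b d = m a b (m c b d)).

Definition maj (x y z : bool) : bool := [|| x && y, y && z | x && z].
Definition cube_median (k : nat) (x y z : {ffun 'I_k -> bool}) : {ffun 'I_k -> bool} :=
  [ffun i => maj (x i) (y i) (z i)].

Definition contains_cube (T : Type) (m : T -> T -> T -> T) (k : nat) : Prop :=
  exists f : {ffun 'I_k -> bool} -> T, injective f /\
    forall x y z, f (cube_median x y z) = m (f x) (f y) (f z).

Definition rank_le (T : Type) (m : T -> T -> T -> T) (n : nat) : Prop :=
  forall k, contains_cube m k -> (k <= n)%N.

Definition coarse_median_rank_le (R : realType) (X : Type) (d : X -> X -> R)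
    (mu : X -> X -> X -> X) (n : nat) : Prop :=
  is_metric d /\
  (forall a b, mu a a b = a) /\
  sym3 mu /\
  exists (K H0 : R) (H : nat -> R),
    (forall p, 0 <= H p) /\
    (forall a b c a' b' c',
       d (mu a b c) (mu a' b' c') <= K * (d a a' + d b b' + d c c') + H0) /\
    (* (C2), finite A given as an injective enumeration a : 'I_k -> X *)
    (forall (p k : nat) (a : 'I_k -> X), injective a -> (1 <= k <= p)%N ->
       exists (Pi : finType) (m : Pi -> Pi -> Pi -> Pi),
         is_median_algebra m /\ rank_le m n /\
         exists (pi : 'I_k -> Pi) (lam : Pi -> X),
           (forall x y z, simr d (H p) (lam (m x y z)) (mu (lam x) (lam y) (lam z))) /\
           (forall i, simr d (H p) (lam (pi i)) (a i))).

Definition in_interval (X : Type) (mu : X -> X -> X -> X) (a b e : X) : Prop :=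
  exists y, e = mu a y b.

(* Main.v *)
(* Median homomorphisms to {0,1} separate the points of every median algebra, so
   identities may be checked on Booleans.

   If (X, d, mu) has rank at most n, then a, b and the e_i are approximated in a
   finite median algebra of rank at most n.  There the interval from a to b is a
   distributive lattice with bottom a; let g be the join of the pairwise meets of
   the e_i.  The elements e_i \/ g are pairwise disjoint over g, so they span an
   (n+1)-cube unless some e_i \/ g equals g; and g is close to a, e_i \/ g to e_i.

   Conversely, functions X^k -> X up to bounded distance form a median algebra by
   (C1)' and (C2)'.  By separation, two median expressions in k variables with the
   same Boolean function have values at bounded distance, uniformly in the
   arguments; as there are finitely many Boolean functions, the free median
   algebra on k generators approximates every k points of X.  If the algebra,
   viewed on a set V of Boolean coordinates, contains an (n+1)-cube, (C3)' provides
   an edge (u, v) of that cube with short image.  Points of X are then changed by a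
   bounded amount when the coordinates separating u from v are removed from V.
   After at most 2^k such steps the rank is at most n. *)

Require Import Defs.
From mathcomp Require Import all_boot all_order all_algebra all_fingroup.
From mathcomp Require Import boolp classical_sets reals ring.
Set Implicit Arguments. Unset Strict Implicit. Unset Printing Implicit Defensive.
Import Order.TTheory GRing.Theory Num.Theory.
Local Open Scope ring_scope.

(** * Median algebras *)

(** For a fixed [a] this is the order [x <= y] of the median semilattice based at [a]; the meet of
    [p] and [q] is [m p a q]. The lemmas below are read in this order. *)
Definition between {T : Type} (m : T -> T -> T -> T) (a x b : T) : Prop := m x a b = x.

Definition majhom {T : Type} (m : T -> T -> T -> T) (h : T -> bool) : Prop :=
  forall x y z, h (m x y z) = maj (h x) (h y) (h z).

Section MedianAlgebra.
Variables (T : Type) (m : T -> T -> T -> T).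
Hypothesis mid : forall a b, m a a b = a.
Hypothesis m12 : forall a b c, m a b c = m b a c.
Hypothesis m23 : forall a b c, m a b c = m a c b.
Hypothesis massoc : forall a b c d, m (m a b c) b d = m a b (m c b d).
Local Notation bt := (between m).

Let m13 a b c : m a b c = m c b a.
Proof. by rewrite m12 m23 m12. Qed.

Lemma between_sym a x b : bt a x b -> bt b x a.
Proof. by rewrite /between m23. Qed.

Lemma between_l a b : bt a a b. Proof. exact: mid. Qed.

Lemma between_r a b : bt a b b. Proof. exact/between_sym/between_l. Qed.

Lemma between_trans a x y z : bt a x y -> bt a y z -> bt a x z.
Proof. by rewrite /between => xy yz; rewrite -{1}xy massoc yz xy. Qed.

Lemma between_transr a x y z : bt a x y -> bt a y z -> bt x y z.
Proof.
rewrite /between => xy yz; rewrite m12 -{1}xy (m23 x) massoc (m12 a) yz.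
by rewrite m13 mid.
Qed.

Lemma between_anti a x y : bt a x y -> bt a y x -> x = y.
Proof. by rewrite /between => xy yx; rewrite -xy m13 yx. Qed.

Lemma between_med a x b : bt a (m a x b) b.
Proof. by rewrite /between (m12 a) massoc (m23 b) mid. Qed.

Lemma between_medl a p q : bt a (m p a q) p.
Proof. by rewrite (m12 p) (m23 a); apply: between_med. Qed.

Lemma between_medr a p q : bt a (m p a q) q.
Proof. by rewrite (m13 p); apply: between_medl. Qed.

Lemma between_med_max a x p q : bt a x p -> bt a x q -> bt a x (m p a q).
Proof. by rewrite /between => xp xq; rewrite -massoc xp xq. Qed.

Lemma between_diag a x : bt a x a -> x = a.
Proof. by rewrite /between m13 mid => ->. Qed.

(** Seen from [u], the point [w] is below both [x] and [y], hence below their meet, which is [u]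
    itself. *)
Lemma med_uniq w x y z : bt x w y -> bt x w z -> bt y w z -> w = m x y z.
Proof.
move=> xy xz yz; set u := m x y z.
have xu : bt x w u by rewrite /u m12; apply: between_med_max.
have yu : bt y w u.
  by rewrite /u; apply: between_med_max => //; apply: between_sym.
have ue : m x u y = u by rewrite m12; have := between_med x z y; rewrite m23.
apply: between_diag; rewrite -[X in bt _ _ X]ue.
by apply: between_med_max; apply: between_sym.
Qed.

(* In the interval [w, x], ordered from w, the points al and be are complements
   and v is disjoint from both.  The meet of the joins of v with al and with be
   is again v (uniqueness of m al v be), so al and al \/ v are both complements
   of be; uniqueness of medians then forbids al <> al \/ v. *)
Lemma between_corner a b v w x :
  bt a x b -> bt a w b -> bt v w a -> bt v w b -> bt w v x -> v = w.
Proof.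
move=> axb awb vwa vwb wvx.
pose al := m x w a; pose be := m x w b.
have [wal ala xal] : [/\ bt w al x, bt w al a & bt x al a].
  by split; [apply: between_medl | apply: between_medr | apply: between_med].
have [wbe beb xbe] : [/\ bt w be x, bt w be b & bt x be b].
  by split; [apply: between_medl | apply: between_medr | apply: between_med].
have awl : bt v w al.
  by apply: between_sym; apply: (between_transr (a := a)); apply: between_sym.
have awe : bt v w be.
  by apply: between_sym; apply: (between_transr (a := b)); apply: between_sym.
have alxbe : bt al x be.
  apply/between_sym/(between_transr (a := b)); first exact: between_sym.
  by apply/between_sym/(between_transr (a := a)) => //; exact: between_sym.
have alwbe : bt al w be.
  apply/between_sym/(between_transr (a := b)); first exact: between_sym.
  by apply/between_sym/(between_transr (a := a)) => //; exact: between_sym.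
pose ga := m al x v; pose de := m be x v; pose ep := m ga w de.
have [xga gav alga] : [/\ bt x ga al, bt x ga v & bt al ga v].
  by split; [apply: between_medl | apply: between_medr | apply: between_med].
have [xde dev bede] : [/\ bt x de be, bt x de v & bt be de v].
  by split; [apply: between_medl | apply: between_medr | apply: between_med].
have vga : bt w v ga.
  by apply/between_sym/(between_transr gav)/between_sym.
have vde : bt w v de.
  by apply/between_sym/(between_transr dev)/between_sym.
have wep : bt w v ep by apply: between_med_max.
have vepal : bt v ep al.
  apply: (between_trans _ (between_sym alga)).
  by apply: (between_transr wep); apply: between_medl.
have vepbe : bt v ep be.
  apply: (between_trans _ (between_sym bede)).
  by apply: (between_transr wep); apply: between_medr.
have epv : ep = v.
  apply: (between_anti (a := w)) => //; apply: between_sym.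
  have -> : w = m al v be by rewrite m12; apply: med_uniq.
  exact: between_med_max.
have gabe : bt ga w be.
  pose b' := m ga w be.
  have wb'v : bt w b' v.
    rewrite -epv; apply: between_med_max; first exact: between_medl.
    apply: (between_trans (y := be)); first exact: between_medr.
    by apply/between_sym/(between_transr xde)/between_sym.
  have b'w : b' = w.
    apply: between_diag; rewrite -[X in bt _ _ X](_ : m v w be = w).
      by apply: between_med_max => //; apply: between_medr.
    by rewrite m12.
  by rewrite /between m12.
have alga' : al = ga.
  apply: (between_anti (a := be)); apply: between_sym.
    apply: (between_trans _ gabe); exact: between_transr (between_sym wal).
  exact: between_trans (between_sym xga) alxbe.
apply: (between_anti (a := al)); last exact: between_sym.
by rewrite {1}alga'; apply: between_sym.
Qed.

(** Intervals are gated. The meet [v] of the gate [w] and [x], seen from [z], meets the conditions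
    of [between_corner], so it equals [w]. *)
Lemma gate a x b z : bt a x b -> bt z (m a z b) x.
Proof.
move=> axb; set w := m a z b; pose v := m w z x.
have [zw zx] : bt z v w /\ bt z v x.
  by split; [apply: between_medl | apply: between_medr].
have [wa wb] : bt z w a /\ bt z w b.
  by split; [apply: between_medl | apply: between_medr].
suff <- : v = w by [].
apply: (between_corner axb); first exact: between_med.
- exact: between_transr zw wa.
- exact: between_transr zw wb.
pose g := m w v x.
have wgv : bt w g v by apply/between_sym/between_medl.
have xgv : bt x g v by apply/between_sym/between_medr.
have gv : g = v.
  apply: (between_anti (a := z)).
    apply: between_med_max; apply: between_sym.
      exact: between_trans wgv (between_sym zw).
    exact: between_trans xgv (between_sym zx).
  exact/between_sym/(between_transr wgv)/between_sym.
by rewrite /between m12.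
Qed.

(** Seen from [c], the gate of the interval is the meet of [p] and [q], so it is above [y]; every
    [z] in the interval is above the gate. *)
Lemma between_convex y c p q z :
  bt c y p -> bt c y q -> bt p z q -> bt c y z.
Proof.
move=> yp yq pzq; apply: between_trans (gate c pzq).
exact: between_med_max.
Qed.

(* A maximal proper filter of the semilattice (p, q) |-> m p y q, whose bottom is
   y, is a half-space. *)
Lemma separation x y : x <> y -> exists h, majhom m h /\ h x <> h y.
Proof.
(* The last clause forces [x] into every nonempty filter but admits the empty set, the union of the
   empty chain. *)
move=> xy; have [|U [[Ucl Uup Uy Ux] Umax]] := @Zorn_bigcup T (fun U =>
    [/\ forall p q, U p -> U q -> U (m p y q),
        forall p q, U p -> bt y p q -> U q, ~ U y & forall p, U p -> U x]).
  move=> F FP Ftot; split.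
  - move=> p q [A FA Ap] [B FB Bq].
    have [/(_ p Ap) Bp|/(_ q Bq) Aq] := Ftot _ _ FA FB.
      by exists B => //; case: (FP _ FB) => + _ _ _; apply.
    by exists A => //; case: (FP _ FA) => + _ _ _; apply.
  - by move=> p q [A FA Ap] ypq; exists A => //; case: (FP _ FA) => _ up _ _; exact: up ypq.
  - by move=> [A FA Ay]; case: (FP _ FA).
  - by move=> p [A FA Ap]; exists A => //; case: (FP _ FA) => _ _ _; apply; exact: Ap.
(* Otherwise [U] is empty and the principal filter of [x] is larger. *)
have {}Ux : U x.
  apply: contrapT => nUx; apply: (Umax (fun q => bt y x q)).
    by split=> [p /Ux//|/(_ x (between_r y x))].
  split=> //.
  - by move=> p q; apply: between_med_max.
  - by move=> p q; apply: between_trans.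
  - by move/between_diag.
  - by move=> _ _; apply: between_r.
(* Otherwise [U] and [p] generate a larger proper filter [B]. *)
have Uopp p : ~ U p -> exists2 c, U c & m c y p = y.
  move=> nUp; apply: contrapT => nc.
  pose B q := exists2 c, U c & bt y (m c y p) q.
  apply: (Umax B).
    split=> [q Uq|BU]; first by exists q => //; apply: between_medl.
    by apply/nUp/BU; exists x => //; apply: between_medr.
  split.
  - move=> q r [c Uc cq] [e Ue er]; exists (m c y e); first exact: Ucl.
    apply: between_med_max.
      apply: between_trans cq; apply: between_med_max; last exact: between_medr.
      exact: between_trans (between_medl _ _ _) (between_medl _ _ _).
    apply: between_trans er; apply: between_med_max; last exact: between_medr.
    exact: between_trans (between_medl _ _ _) (between_medr _ _ _).
  - by move=> q r [c Uc cq] qr; exists c => //; apply: between_trans qr.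
  - by move=> [c Uc /between_diag cy]; apply: nc; exists c.
  - by move=> _ _; exists x => //; apply: between_medl.
have U2 p r q : U p -> U q -> U (m p r q).
  by move=> Up Uq; apply: (Uup _ _ (Ucl _ _ Up Uq)); apply/gate/between_med.
(* Both [p] and [q] have meet [y] with the common element [m c y e] of [U]; by convexity so has
   [m p r q]. *)
have U0 p r q : ~ U p -> ~ U q -> ~ U (m p r q).
  move=> /Uopp[c Uc cp] /Uopp[e Ue eq] Uz; apply: Uy.
  suff <- : m (m c y e) y (m p r q) = y by apply/Ucl/Uz/Ucl.
  rewrite m12; apply: (@between_convex _ _ p q); last exact: between_med.
    apply: (@between_transr c); last by rewrite /between m12.
    exact/between_sym/between_medl.
  apply: (@between_transr e); last by rewrite /between m12.
  exact/between_sym/between_medr.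
exists (fun t => `[<U t>]); split; last by rewrite (asboolT Ux) (asboolF Uy).
move=> p q r; rewrite /maj.
case: (asboolP (U p)) (asboolP (U q)) (asboolP (U r)) => up [] uq [] ur /=;
  apply/asboolP.
- exact: U2.
- by rewrite m23; apply: U2.
- exact: U2.
- by rewrite m12; apply: U0.
- by rewrite m12; apply: U2.
- exact: U0.
- by rewrite m23; apply: U0.
- exact: U0.
Qed.

End MedianAlgebra.

(** This is separation in the quotient by [E], whose classes are encoded as the predicates [E a]. *)
Lemma separation_upto (T : Type) (m : T -> T -> T -> T) (E : T -> T -> Prop) :
  (forall a, E a a) -> (forall a b, E a b -> E b a) ->
  (forall a b c, E a b -> E b c -> E a c) ->
  (forall a b c a' b' c', E a a' -> E b b' -> E c c' -> E (m a b c) (m a' b' c')) ->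
  (forall a b, E (m a a b) a) ->
  (forall a b c, E (m a b c) (m b a c)) ->
  (forall a b c, E (m a b c) (m a c b)) ->
  (forall a b c e, E (m (m a b c) b e) (m a b (m c b e))) ->
  forall x y, ~ E x y -> exists h, majhom m h /\ h x <> h y.
Proof.
move=> Er Es Et Em mid m12 m23 massoc x y nxy.
pose Q := {P : T -> Prop | exists a, P = E a}.
pose cl a : Q := exist _ (E a) (ex_intro _ a erefl).
have clE a b : E a b -> cl a = cl b.
  move=> ab; apply/eq_exist/predeqP => c.
  by split; apply: Et => //; apply: Es.
have clI a b : cl a = cl b -> E a b.
  by move=> /(congr1 sval) /= ->.
have [|rp rpK] := @choice Q T (fun q a => cl a = q).
  by move=> [P Pa]; case: (Pa) => a Pe; exists a; apply/eq_exist.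
have rpE a : E (rp (cl a)) a by apply/clI/rpK.
pose mQ p q r := cl (m (rp p) (rp q) (rp r)).
have mQE a b c : mQ (cl a) (cl b) (cl c) = cl (m a b c) by apply/clE/Em; apply: rpE.
have [p q|p q r|p q r|p q r s||h [hm hxy]] := @separation Q mQ _ _ _ _ (cl x) (cl y).
- by rewrite -(rpK p) -(rpK q) mQE; apply/clE/mid.
- by rewrite -(rpK p) -(rpK q) -(rpK r) !mQE; apply/clE/m12.
- by rewrite -(rpK p) -(rpK q) -(rpK r) !mQE; apply/clE/m23.
- by rewrite -(rpK p) -(rpK q) -(rpK r) -(rpK s) !mQE; apply/clE/massoc.
- by move/clI.
exists (h \o cl); split=> // a b c.
by rewrite /= -mQE hm.
Qed.

Lemma sym3P (T : Type) (m : T -> T -> T -> T) :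
  sym3 m <-> (forall a b c, m a b c = m b a c) /\ (forall a b c, m a b c = m a c b).
Proof.
have o1 : nat_of_ord (inord 1 : 'I_3) = 1%N by rewrite inordK.
have o2 : nat_of_ord (inord 2 : 'I_3) = 2%N by rewrite inordK.
have n01 : (ord0 == inord 1 :> 'I_3) = false by apply/eqP => /(congr1 val); rewrite /= o1.
have n02 : (ord0 == inord 2 :> 'I_3) = false by apply/eqP => /(congr1 val); rewrite /= o2.
have n12 : (inord 1 == inord 2 :> 'I_3) = false.
  by apply/eqP => /(congr1 val); rewrite /= o1 o2.
split=> [ms|[m12 m23] s a].
  split=> a b c; pose f (i : 'I_3) := nth a [:: a; b; c] i.
    have := ms (tperm ord0 (inord 1)) f; rewrite tpermL tpermR tpermD ?n02 ?n12 //.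
    by rewrite /f /= o1 o2.
  have := ms (tperm (inord 1) (inord 2)) f.
  rewrite tpermL tpermR tpermD 1?eq_sym ?n01 ?n02 //.
  by rewrite /f /= o1 o2.
have ord3 (i : 'I_3) : [\/ i = ord0, i = inord 1 | i = inord 2].
  case: i => [[|[|[|?]]] Hi] => [|||//]; [constructor 1|constructor 2|constructor 3];
    by apply/val_inj; rewrite /= ?o1 ?o2.
have inj i j : i != j -> s i <> s j by move=> /eqP ij /perm_inj.
have := inj _ _ (negbT n01); have := inj _ _ (negbT n02); have := inj _ _ (negbT n12).
case: (ord3 (s ord0)) (ord3 (s (inord 1))) (ord3 (s (inord 2))) => -> [] -> [] -> // _ _ _.
- by rewrite m23 m12.
- by rewrite m12 m23.
- by rewrite m12 m23 m12.
Qed.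

(** * Cubes and Boolean coordinates *)

Lemma contains_cube_le (T : Type) (m : T -> T -> T -> T) (j k : nat) :
  (j <= k)%N -> contains_cube m k -> contains_cube m j.
Proof.
move=> jk [f [finj fm]].
pose e (s : {ffun 'I_j -> bool}) : {ffun 'I_k -> bool} :=
  [ffun i : 'I_k => if insub (i : nat) is Some i' then s (i' : 'I_j) else false].
have eE s (i : 'I_j) : e s (widen_ord jk i) = s i.
  by rewrite ffunE insubT //= => p; congr (s _); apply: val_inj.
exists (f \o e); split=> [s t /finj /ffunP st|x y z].
  by apply/ffunP => i; rewrite -!eE st.
rewrite /= -fm; congr f; apply/ffunP => i; rewrite !ffunE.
by case: insub => // i'; rewrite ffunE.
Qed.

Lemma rank_leP (T : Type) (m : T -> T -> T -> T) (n : nat) :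
  ~ contains_cube m n.+1 -> rank_le m n.
Proof.
move=> nc k ck; rewrite leqNgt; apply/negP => nk; apply: nc.
exact: contains_cube_le ck.
Qed.

Lemma fin_bound (R : realType) (I : finType) (P : I -> R -> Prop) :
  (forall i C C', C <= C' -> P i C -> P i C') -> (forall i, exists C, P i C) ->
  exists2 C, 0 <= C & forall i, P i C.
Proof.
move=> Pmono /choice[f fP]; exists (\sum_i `|f i|); first exact: sumr_ge0.
move=> i; apply: Pmono (fP i); rewrite (bigD1 i) //=.
by apply: le_trans (ler_norm _) _; rewrite lerDl sumr_ge0.
Qed.

Definition majf {W : finType} (f g h : {ffun W -> bool}) : {ffun W -> bool} :=
  [ffun w => maj (f w) (g w) (h w)].

(** Coordinates outside [V] become false instead of being dropped, so the type does not change with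
    [V]. *)
Definition restr {W : finType} (V : {set W}) (f : {ffun W -> bool}) : {ffun W -> bool} :=
  [ffun w => (w \in V) && f w].

Lemma restr_maj (W : finType) (V : {set W}) f g h :
  restr V (majf f g h) = majf (restr V f) (restr V g) (restr V h).
Proof. by apply/ffunP => w; rewrite !ffunE; case: (w \in V). Qed.

Lemma restr_eqP (W : finType) (V : {set W}) f g :
  restr V f = restr V g <-> {in V, f =1 g}.
Proof.
split=> [/ffunP fg w wV|fg]; first by have := fg w; rewrite !ffunE wV.
by apply/ffunP => w; rewrite !ffunE; case: (boolP (w \in V)) => //= /fg.
Qed.

Definition maj_closed {W : finType} (B : {set {ffun W -> bool}}) : Prop :=
  forall f g h, f \in B -> g \in B -> h \in B -> majf f g h \in B.

(** A cube in the restriction of [B] to [V], given by representatives in [B]; its equations hold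
    only after restriction. *)
Definition cube_on {W : finType} (B : {set {ffun W -> bool}}) (V : {set W}) (k : nat)
    (z : {ffun 'I_k -> bool} -> {ffun W -> bool}) : Prop :=
  [/\ forall s, z s \in B, forall s t, restr V (z s) = restr V (z t) -> s = t
    & forall r s t, restr V (z (cube_median r s t)) = restr V (majf (z r) (z s) (z t))].

Definition coord {k : nat} (i : 'I_k) : {ffun {ffun 'I_k -> bool} -> bool} :=
  [ffun w : {ffun 'I_k -> bool} => w i].

(* gen mu f F: some median expression in k variables has Boolean values f and
   values F in X. *)
Inductive gen {X : Type} (mu : X -> X -> X -> X) (k : nat) :
    {ffun {ffun 'I_k -> bool} -> bool} -> (('I_k -> X) -> X) -> Prop :=
| gen_var i : gen mu (coord i) (fun a => a i)
| gen_med f g h F G E : gen mu f F -> gen mu g G -> gen mu h E ->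
    gen mu (majf f g h) (fun a => mu (F a) (G a) (E a)).

(** The algebra is the image of [B] under [restr V], where the median axioms hold coordinatewise;
    [lift] chooses preimages. *)
Lemma restr_algebra (W : finType) (B : {set {ffun W -> bool}}) (V : {set W}) (n : nat) :
  maj_closed B -> (~ exists z : {ffun 'I_n.+1 -> bool} -> _, cube_on B V z) ->
  exists (P : finType) (m : P -> P -> P -> P) (lift : P -> {ffun W -> bool}),
    [/\ is_median_algebra m, rank_le m n, forall p, lift p \in B,
        forall x y z, restr V (lift (m x y z)) = restr V (majf (lift x) (lift y) (lift z))
      & forall f, f \in B -> exists p, restr V (lift p) = restr V f].
Proof.
move=> Bc nz; pose A := restr V @: B.
have AP (f : {ffun W -> bool}) : f \in B -> restr V f \in A by apply: imset_f.
pose P := ({f | f \in A})%type.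
have [|lift liftP] := @choice P {ffun W -> bool} (fun p f => f \in B /\ restr V f = val p).
  by move=> [p /= /imsetP[f fB ->]]; exists f.
have liftB p : lift p \in B by case: (liftP p).
have liftE p : restr V (lift p) = val p by case: (liftP p).
pose toP f (fB : f \in B) : P := exist (fun g => is_true (g \in A)) _ (AP f fB).
pose m x y z := toP _ (Bc _ _ _ (liftB x) (liftB y) (liftB z)).
have mE x y z : val (m x y z) = majf (val x) (val y) (val z).
  by rewrite /= restr_maj !liftE.
exists P, m, lift; split=> //.
- split; [|split; first (apply/sym3P; split)] => *; apply: val_inj;
    rewrite !mE; apply/ffunP => w; rewrite !ffunE /maj;
    by do ![case: (fun_of_fin _ w)].
- apply: rank_leP => -[f [finj fm]]; apply: nz; exists (lift \o f); split=> //=.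
    by move=> s t; rewrite !liftE => /val_inj /finj.
  by move=> r s t; rewrite liftE fm mE restr_maj !liftE.
- by move=> f fB; exists (toP f fB); rewrite liftE.
Qed.

Lemma separation_at (T : Type) (m : T -> T -> T -> T) (a x y : T) :
  is_median_algebra m -> x <> y ->
  exists h, [/\ majhom m h, h a = false & h x <> h y].
Proof.
move=> [mid [/sym3P[m12 m23] massoc]] /(separation mid m12 m23 massoc)[h [hm hxy]].
(* Majority commutes with negation, so [h] may be negated to vanish at [a]. *)
exists (fun t => h t (+) h a); split; last 1 first.
- by move/addIb.
- by move=> p q r; rewrite hm /maj; case: (h p) (h q) (h r) (h a) => [] [] [] [].
- exact: addbb.
Qed.

Definition offdiag (n : nat) : seq ('I_n * 'I_n) :=
  [seq p <- enum {: 'I_n * 'I_n} | p.1 != p.2].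

(* In the distributive lattice [a, b] with bottom a, g is the join of the pairwise
   meets of the f i, so the f i \/ g are pairwise disjoint over g. *)
Lemma corner_collapse (T : Type) (m : T -> T -> T -> T) (n : nat) (a b : T)
    (x : 'I_n.+1 -> T) :
  is_median_algebra m -> rank_le m n ->
  let f i := m a (x i) b in
  let g := foldr (fun p acc => m (m (f p.1) a (f p.2)) b acc) a (offdiag n.+1) in
  exists i, m (f i) b g = g.
Proof.
move=> mm mr f g; apply: contrapT => /forallNP ng.
(* In the interval, the join is the median with [b]; the vertex [S] is the join of [g] with the
   selected [f i]. *)
pose z (S : {ffun 'I_n.+1 -> bool}) :=
  foldr (fun i acc => if S i then m (f i) b acc else acc) g (enum 'I_n.+1).
suff /mr : contains_cube m n.+1 by rewrite ltnn.
have join (p q r : bool) : (p ==> q) -> (r ==> q) -> maj p q r = p || r.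
  by case: p q r => [] [] [].
have homs h : majhom m h -> h a = false ->
  [/\ forall i, h (m (f i) b g) = h (f i) || h g,
      h g = has (fun p => h (f p.1) && h (f p.2)) (offdiag n.+1)
    & forall S, h (z S) = h g || has (fun i => S i && h (f i)) (enum 'I_n.+1)].
  move=> hm ha.
  have fb i : h (f i) ==> h b by rewrite hm ha /maj; case: (h b) (h (x i)) => [] [].
  have [gE gb] : h g = has (fun p => h (f p.1) && h (f p.2)) (offdiag n.+1) /\ (h g ==> h b).
    rewrite /g; elim: (offdiag _) => [|p l [IH IHb]] /=; first by rewrite ha.
    have meet : h (m (f p.1) a (f p.2)) = h (f p.1) && h (f p.2).
      by rewrite hm ha; case: (h (f p.1)) (h (f p.2)) => [] [].
    rewrite hm meet.
    have pb : h (f p.1) && h (f p.2) ==> h b.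
      by move: (fb p.1); case: (h (f p.1)) (h (f p.2)) => [] [].
    rewrite join // IH; split=> //.
    by rewrite -IH; move: pb IHb; case: (_ && _).
  split=> // [i|S]; first by rewrite hm join.
  have [] // : h (z S) = h g || has (fun i => S i && h (f i)) (enum 'I_n.+1) /\ (h (z S) ==> h b).
  rewrite /z; elim: (enum _) => [|i l [IH IHb]] /=; first by rewrite orbF.
  case: (S i) => //=; rewrite hm join //; split; first by rewrite IH orbCA.
  by move: (fb i) IHb; case: (h (f i)).
(* Where [g] is false, at most one [f i] is true, and the vertex then reads off [S i]. *)
have zcoord h S i : majhom m h -> h a = false -> h g = false -> h (f i) -> h (z S) = S i.
  move=> hm ha hg hi; have [_ gE ->] := homs h hm ha; rewrite hg /=.
  apply/hasP/idP => [[j _ /andP[Sj hj]]|Si]; last by exists i; rewrite ?mem_enum ?Si.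
  have [<- //|ij] := eqVneq j i.
  move: hg; rewrite gE => /negbT /hasPn /(_ (j, i)).
  by rewrite mem_filter mem_enum /= ij hi hj => /(_ isT).
exists z; split=> [S S' SS'|r s t].
  (* A coordinate separating [f i] joined with [g] from [g] has [g] false and [f i] true, so it
     recovers [S i]. *)
  apply/ffunP => i; have [h [hm ha]] := separation_at a mm (ng i).
  have [-> _ _] := homs h hm ha.
  case hg: (h g); first by rewrite orbT.
  by rewrite orbF; case hi: (h (f i)) => // _; rewrite -!(zcoord h _ i) // SS'.
apply: contrapT => /(separation_at a mm)[h [hm ha]]; apply; rewrite hm.
case hg: (h g); first by have [_ _ zE] := homs h hm ha; rewrite !zE hg.
have [[i hi]|nf] := pselect (exists i, h (f i)).
  by rewrite !(zcoord h _ i) // ffunE.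
have zF S : h (z S) = false.
  have [_ _ ->] := homs h hm ha; rewrite hg; apply/hasPn => i _.
  by apply/negP => /andP[_ hi]; apply: nf; exists i.
by rewrite !zF.
Qed.

(** * Approximation by finite median algebras *)

Definition approximates {R : realType} {X : Type} (d : X -> X -> R)
    (mu : X -> X -> X -> X) (n : nat) (D : R) (k : nat) (a : 'I_k -> X) : Prop :=
  exists (P : finType) (m : P -> P -> P -> P),
    is_median_algebra m /\ rank_le m n /\
    exists (pi : 'I_k -> P) (lam : P -> X),
      (forall x y z, simr d D (lam (m x y z)) (mu (lam x) (lam y) (lam z))) /\
      (forall i, simr d D (lam (pi i)) (a i)).

Section Coarse.
Variables (R : realType) (X : Type) (d : X -> X -> R) (mu : X -> X -> X -> X).
Hypothesis dmet : is_metric d.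
Variables (K H0 : R).
Hypotheses (K_ge0 : 0 <= K) (H0_ge0 : 0 <= H0).

Lemma dist_ge0 x y : 0 <= d x y. Proof. by case: dmet. Qed.

Lemma distxx x : d x x = 0. Proof. by case: dmet => _ [/(_ x x)[_ +] _]; apply. Qed.

Lemma distC x y : d x y = d y x. Proof. by case: dmet => _ [_ []]. Qed.

Lemma dist_trans y x z r s : d x y <= r -> d y z <= s -> d x z <= r + s.
Proof.
by move=> xy yz; case: dmet => _ [_ [_ /(_ x y z) /le_trans]]; apply; apply: lerD.
Qed.

Lemma dist_trans_sym y x z r s : d y x <= r -> d y z <= s -> d x z <= r + s.
Proof. by rewrite distC; apply: dist_trans. Qed.

Section Affine.
Hypothesis mid : forall a b, mu a a b = a.
Hypothesis m12 : forall a b c, mu a b c = mu b a c.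
Hypothesis m23 : forall a b c, mu a b c = mu a c b.
Hypothesis mu_lip1 : forall a a' b c, d (mu a b c) (mu a' b c) <= K * d a a' + H0.

Lemma mu_lip3 a b c a' b' c' r s t : d a a' <= r -> d b b' <= s -> d c c' <= t ->
  d (mu a b c) (mu a' b' c') <= K * (r + s + t) + (H0 + H0 + H0).
Proof.
move=> ar bs ct.
have lip x x' y z u : d x x' <= u -> d (mu x y z) (mu x' y z) <= K * u + H0.
  by move=> xu; apply: le_trans (mu_lip1 _ _ _ _) _; rewrite lerD2r ler_wpM2l.
have -> : K * (r + s + t) + (H0 + H0 + H0) = (K * r + H0) + ((K * s + H0) + (K * t + H0)).
  by rewrite !mulrDr; ring.
apply: dist_trans (lip _ _ _ _ _ ar) _.
rewrite !(m12 a'); apply: dist_trans (lip _ _ _ _ _ bs) _.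
by rewrite !(m23 _ a') !(m12 b'); apply: lip.
Qed.

(** * From finite approximations to (C2)' and (C3)' *)

Section Forward.
Variables (n : nat) (Hp : nat -> R).
Hypothesis Hp_ge0 : forall p, 0 <= Hp p.
Hypothesis approx : forall (p k : nat) (a : 'I_k -> X), injective a -> (1 <= k <= p)%N ->
  approximates d mu n (Hp p) a.

(** (C2) speaks of injective enumerations, so repetitions are removed first; at most [#|I|] points
    remain. *)
Lemma approx_family (I : finType) (g : I -> X) : (0 < #|I|)%N ->
  exists (P : finType) (m : P -> P -> P -> P) (pi : I -> P) (lam : P -> X),
    [/\ is_median_algebra m, rank_le m n,
        forall x y z, d (lam (m x y z)) (mu (lam x) (lam y) (lam z)) <= Hp #|I|
      & forall i, d (lam (pi i)) (g i) <= Hp #|I|].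
Proof.
move=> I_gt0; pose g' (i : I) : {classic X} := g i.
pose s := undup (codom g').
have gs i : g' i \in s by rewrite mem_undup codom_f.
have ltg i : (index (g' i) s < size s)%N by rewrite index_mem.
have [||P [m [mm [mr [pi [lam [lamm lampi]]]]]]] :=
    @approx #|I| (size s) (fun j => tnth (in_tuple s) j).
- by apply/(@tuple_uniqP _ _ (in_tuple s)); apply: undup_uniq.
- apply/andP; split; last by rewrite (leq_trans (size_undup _)) // size_codom.
  by have /card_gt0P[i _] := I_gt0; apply: leq_ltn_trans (ltg i).
exists P, m, (fun i => pi (Ordinal (ltg i))), lam; split=> // i.
by have := lampi (Ordinal (ltg i)); rewrite /simr (tnth_nth (g' i)) /= nth_index.
Qed.

Lemma lam_med (P : Type) (m : P -> P -> P -> P) (lam : P -> X) D x y z a b c r s t :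
  (forall x y z, d (lam (m x y z)) (mu (lam x) (lam y) (lam z)) <= D) ->
  d (lam x) a <= r -> d (lam y) b <= s -> d (lam z) c <= t ->
  d (lam (m x y z)) (mu a b c) <= D + (K * (r + s + t) + (H0 + H0 + H0)).
Proof. by move=> lm xa yb zc; apply: dist_trans (lm _ _ _) (mu_lip3 xa yb zc). Qed.

Lemma four_point : exists kappa, 0 < kappa /\
  forall a b c e, d (mu (mu a b c) b e) (mu a b (mu c b e)) <= kappa.
Proof.
(* In the approximating algebra the identity is exact. [D1] is the error after one median, [D2] and
   [D3] after the outer median on either side. *)
pose D := Hp #|'I_4|; pose D1 := D + (K * (D + D + D) + (H0 + H0 + H0)).
pose D2 := D + (K * (D1 + D + D) + (H0 + H0 + H0)).
pose D3 := D + (K * (D + D + D1) + (H0 + H0 + H0)).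
have D_ge0 : 0 <= D by apply: Hp_ge0.
exists (D2 + D3 + 1); split.
  by rewrite ltr_wpDl // !(addr_ge0, mulr_ge0).
move=> a b c e.
have [|P [m [pi [lam [[_ [_ massoc]] _ lm lp]]]]] :=
  @approx_family 'I_4 (fun i => nth a [:: a; b; c; e] i); first by rewrite card_ord.
have := lp (inord 0); have := lp (inord 1); have := lp (inord 2); have := lp (inord 3).
rewrite !inordK //=; move: (pi _) (pi _) (pi _) (pi _) => a' b' c' e' ee cc bb aa.
apply: (@le_trans _ _ (D2 + D3)); last by rewrite lerDl.
apply: (dist_trans_sym (y := lam (m (m a' b' c') b' e'))).
  by apply: (lam_med lm) => //; apply: (lam_med lm).
by rewrite massoc; apply: (lam_med lm) => //; apply: (lam_med lm).
Qed.

Variable kappa : R.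
Hypothesis kappaP : forall a b c e, d (mu (mu a b c) b e) (mu a b (mu c b e)) <= kappa.

(** This is the four-point estimate with its last two arguments equal to [a]. *)
Lemma interval_gate a b e : in_interval mu a b e -> d (mu a e b) e <= kappa.
Proof.
move=> [y ->]; have rot p q r : mu p q r = mu r p q by rewrite m23 m12.
by have := kappaP y b a a; rewrite (m23 a b a) mid !(rot _ b a).
Qed.

Lemma corner_bound (lambda : R) : exists C : R,
  forall (a b : X) (e : 'I_n.+1 -> X),
    (forall i, in_interval mu a b (e i)) ->
    (forall i j, i != j -> simr d lambda (mu (e i) a (e j)) a) ->
    exists i, simr d C (e i) a.
Proof.
pose I : finType := option (option 'I_n.+1).
pose D := Hp #|I|.
pose near r s t := D + (K * (r + s + t) + (H0 + H0 + H0)).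
(* [F] bounds the distance from the image of [f i] to [e i], [M] that from the pairwise meets to
   [a], and [G] that from their join [g] to [a], with one join per pair. *)
pose F := near D D D + kappa.
pose M := near F D F + lambda.
pose G := foldr (fun _ r => near M D r) D (offdiag n.+1).
exists (near F D G + kappa + G) => a b e eab emeet.
pose pts (i : I) := if i is Some (Some j) then e j else if i is Some None then b else a.
have [|P [m [pi [lam [mm mr lm lp]]]]] := @approx_family I pts; first by rewrite !card_option.
pose a' := pi None; pose b' := pi (Some None); pose x j := pi (Some (Some j)).
have la : d (lam a') a <= D := lp None.
have lb : d (lam b') b <= D := lp (Some None).
have lf i : d (lam (m a' (x i) b')) (e i) <= F.
  apply: dist_trans (interval_gate (eab i)).
  by apply: (lam_med lm) => //; apply: (lp (Some (Some i))).
have [i] := corner_collapse a' b' x mm mr; set g := foldr _ _ _ => fg.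
have lg : d (lam g) a <= G.
  rewrite /g /G; have : forall p, p \in offdiag n.+1 -> p.1 != p.2.
    by move=> p; rewrite mem_filter => /andP[].
  elim: (offdiag _) => [|p l IH] //= pl.
  have aba : mu a b a = a by rewrite m23 mid.
  rewrite -[X in d _ X]aba; apply: (lam_med lm) => //; last first.
    by apply: IH => q ql; apply: pl; rewrite inE ql orbT.
  apply: dist_trans (emeet p.1 p.2 _); last by apply: pl; rewrite inE eqxx.
  exact: (lam_med lm).
exists i; rewrite /simr; apply: (dist_trans_sym _ lg); rewrite -fg.
apply: (dist_trans (y := mu (e i) b a)); first exact: (lam_med lm).
by rewrite m23 (m12 (e i)); apply: interval_gate.
Qed.

End Forward.

(** * From (C2)' and (C3)' to finite approximations *)

Section Backward.
Variable kappa : R.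
Hypothesis kappaP : forall a b c e, d (mu (mu a b c) b e) (mu a b (mu c b e)) <= kappa.

Lemma gen_uniq k (f : {ffun {ffun 'I_k -> bool} -> bool}) F G :
  gen mu f F -> gen mu f G -> exists C, forall a, d (F a) (G a) <= C.
Proof.
move=> fF fG; apply: contrapT => nFG.
have [||||||||h [hm hFG]] := @separation_upto (('I_k -> X) -> X)
   (fun A B C a => mu (A a) (B a) (C a)) (fun A B => exists C, forall a, d (A a) (B a) <= C)
   _ _ _ _ _ _ _ _ F G nFG.
- by move=> A; exists 0 => a; rewrite distxx.
- by move=> A B [C AB]; exists C => a; rewrite distC.
- by move=> A B C [u AB] [v BC]; exists (u + v) => a; apply: dist_trans (AB a) (BC a).
- move=> A B C A' B' C' [u Au] [v Bv] [w Cw].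
  exists (K * (u + v + w) + (H0 + H0 + H0)) => a; exact: mu_lip3.
- by move=> A B; exists 0 => a; rewrite mid distxx.
- by move=> A B C; exists 0 => a; rewrite m12 distxx.
- by move=> A B C; exists 0 => a; rewrite m23 distxx.
- by move=> A B C E; exists kappa => a.
(* A homomorphism [h] on functions sends each expression to its Boolean function at [w], the values
   of [h] at the projections, so it cannot separate [F] from [G]. *)
apply: hFG; pose w := [ffun i : 'I_k => h (fun a => a i)].
have hw f' F' : gen mu f' F' -> h F' = f' w.
  by elim=> [i|g1 g2 g3 G1 G2 G3 _ e1 _ e2 _ e3]; rewrite ?hm ?e1 ?e2 ?e3 !ffunE.
by rewrite (hw _ _ fF) (hw _ _ fG).
Qed.

(** [B] is the free median algebra on [k] generators and [L] picks one expression per element;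
    [gen_uniq] bounds the effect of this choice. *)
Lemma free_median k : (0 < k)%N ->
  exists (B : {set {ffun {ffun 'I_k -> bool} -> bool}})
    (L : {ffun {ffun 'I_k -> bool} -> bool} -> ('I_k -> X) -> X) (D : R),
  [/\ 0 <= D, maj_closed B, forall i, coord i \in B,
      forall i a, d (L (coord i) a) (a i) <= D
    & forall f g h, f \in B -> g \in B -> h \in B -> forall a,
        d (L (majf f g h) a) (mu (L f a) (L g a) (L h a)) <= D].
Proof.
move=> k0; pose Fn := ({ffun {ffun 'I_k -> bool} -> bool})%type.
pose B := [set f : Fn | `[< exists F, gen mu f F >]].
have BP f : f \in B <-> exists F, gen mu f F by rewrite inE; split=> /asboolP.
have [|L LP] := @choice Fn (('I_k -> X) -> X) (fun f F => f \in B -> gen mu f F).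
  move=> f; have [[F fF]|nf] := pselect (exists F, gen mu f F); first by exists F.
  (* Outside [B] any value will do; a projection exists because [k] is positive. *)
  by exists (fun a => a (Ordinal k0)) => /BP.
have Bvar i : coord i \in B.
  by apply/BP; exists (fun a => a i); apply: gen_var.
have Bmed : maj_closed B.
  move=> f g h /LP fF /LP gF /LP hF; apply/BP.
  by eexists; apply: gen_med fF gF hF.
have [|i|D1 D1_ge0 D1P] := @fin_bound R 'I_k (fun i C => forall a,
    d (L (coord i) a) (a i) <= C).
- by move=> i C C' CC' le a; apply: le_trans CC'.
- exact: gen_uniq (LP _ (Bvar i)) (gen_var mu i).
have [|[[f g] h]|D2 D2_ge0 D2P] := @fin_bound R (Fn * Fn * Fn)%type (fun p C =>
    p.1.1 \in B -> p.1.2 \in B -> p.2 \in B -> forall a,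
    d (L (majf p.1.1 p.1.2 p.2) a) (mu (L p.1.1 a) (L p.1.2 a) (L p.2 a)) <= C).
- by move=> p C C' CC' le *; apply: le_trans CC'; apply: le.
- have [[fB gB hB]|nB] := pselect [/\ f \in B, g \in B & h \in B]; last first.
    by exists 0 => /= fB gB hB; case: nB.
  have [C CP] := gen_uniq (LP _ (Bmed _ _ _ fB gB hB)) (gen_med (LP _ fB) (LP _ gB) (LP _ hB)).
  by exists C.
exists B, L, (D1 + D2); split=> //; first exact: addr_ge0.
  by move=> i a; apply: le_trans (D1P i a) _; rewrite lerDl.
move=> f g h fB gB hB a; apply: le_trans (D2P (f, g, h) fB gB hB a) _.
by rewrite lerDr.
Qed.

(** * Removing Boolean coordinates until no (n+1)-cube is left *)

Variable n : nat.

Definition quasi_hom {W : finType} (B : {set {ffun W -> bool}})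
    (L : {ffun W -> bool} -> X) (D : R) : Prop :=
  forall f g h, f \in B -> g \in B -> h \in B ->
    d (L (majf f g h)) (mu (L f) (L g) (L h)) <= D.

(** Up to [D], the map [L] factors through the restriction to [V]. *)
Definition close_on {W : finType} (B : {set {ffun W -> bool}})
    (L : {ffun W -> bool} -> X) (V : {set W}) (D : R) : Prop :=
  forall f g, f \in B -> g \in B -> restr V f = restr V g -> d (L f) (L g) <= D.

Hypothesis corner : forall lambda : R, 0 < lambda -> exists C : R,
  forall (a b : X) (e : 'I_n.+1 -> X),
    (forall i, in_interval mu a b (e i)) ->
    (forall i j, i != j -> simr d lambda (mu (e i) a (e j)) a) ->
    exists i, simr d C (e i) a.

(** The neighbours of the bottom vertex have pairwise medians with it equal to it, so (C3)' applies
    to their images. The bound is independent of the algebra and of the cube. *)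
Lemma short_edge (H D : R) : 0 <= H -> 0 <= D -> exists2 c, 0 <= c &
  forall (W : finType) (B : {set {ffun W -> bool}}) L V
    (z : {ffun 'I_n.+1 -> bool} -> {ffun W -> bool}),
    quasi_hom B L H -> close_on B L V D -> maj_closed B -> cube_on B V z ->
    exists u v, [/\ u \in B, v \in B, restr V u <> restr V v & d (L u) (L v) <= c].
Proof.
move=> H_ge0 D_ge0.
(* Each [e i] is within [H + D] of the image of its vertex, and the median of two vertices costs
   another [H + D]; the 1 ensures positivity. *)
pose lambda := K * ((H + D) + 0 + (H + D)) + (H0 + H0 + H0) + (H + D) + 1.
have lambda_gt0 : 0 < lambda.
  by rewrite /lambda ltr_wpDl // !(addr_ge0, mulr_ge0).
have [C CP] := corner lambda_gt0; exists (`|C| + (H + D)).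
  by rewrite addr_ge0 ?addr_ge0.
move=> W B L V z Lq Lc Bc [zB zinj zmed].
pose s0 := [ffun=> false] : {ffun 'I_n.+1 -> bool}.
pose s1 := [ffun=> true] : {ffun 'I_n.+1 -> bool}.
pose si i := [ffun j => j == i] : {ffun 'I_n.+1 -> bool}.
(* (C3)' needs points exactly in the interval, so the images of the vertices are projected into
   it. *)
pose e i := mu (L (z s0)) (L (z (si i))) (L (z s1)).
have eL i : d (e i) (L (z (si i))) <= H + D.
  apply: dist_trans_sym; first exact: Lq.
  apply: Lc => //; first exact: Bc.
  rewrite -zmed; congr (restr V (z _)); apply/ffunP => j.
  by rewrite !ffunE /maj /= andbT; case: (j == i).
have [i||i] := CP (L (z s0)) (L (z s1)) e; first by exists (L (z (si i))).
  move=> i j ij; rewrite /simr.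
  apply: (@le_trans _ _ (lambda - 1)); last by rewrite gerBl.
  rewrite /lambda addrK.
  have le0 : d (L (z s0)) (L (z s0)) <= 0 by rewrite distxx.
  apply: (dist_trans (mu_lip3 (eL i) le0 (eL j))).
  apply: dist_trans_sym; first exact: Lq.
  apply: Lc => //; first exact: Bc.
  rewrite -zmed; congr (restr V (z _)); apply/ffunP => l.
  rewrite !ffunE /maj /= andbF /=; case: (l =P i) => //= ->.
  exact: negbTE.
rewrite /simr => ei; exists (z s0), (z (si i)); split=> //.
  by move/zinj/ffunP/(_ i); rewrite !ffunE eqxx.
apply: dist_trans_sym (eL i).
exact: le_trans ei (ler_norm _).
Qed.

(** From the inside out: the length [c] of the edge, the distance between the images of [x] and [y]
    in the next proof, and the distance from [f] to [x], doubled to account for [g]. *)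
Definition collapse_err (H D c : R) : R :=
  2 * (D + (H + (K * (0 + 0 + (H + ((K * (0 + 0 + c) + (H0 + H0 + H0)) + H)))
                 + (H0 + H0 + H0)))).

(* If f and g differ on V only where u and v differ, then on V both lie between
   x = majf f g u and y = majf f g v, whose images are close. *)
Lemma collapse_edge (H D c : R) (W : finType) (B : {set {ffun W -> bool}}) L V u v :
  quasi_hom B L H -> close_on B L V D -> maj_closed B ->
  u \in B -> v \in B -> d (L u) (L v) <= c ->
  close_on B L [set w in V | u w == v w] (collapse_err H D c).
Proof.
move=> Lq Lc Bc uB vB uv f g fB gB /restr_eqP fg; rewrite /collapse_err.
set e := H + (_ + H); set r := D + _.
pose x := majf f g u; pose y := majf f g v.
have xB : x \in B by apply: Bc.
have yB : y \in B by apply: Bc.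
have xy : d (L y) (L x) <= e.
  rewrite distC; apply: dist_trans; first exact: Lq.
  apply: (dist_trans (y := mu (L f) (L g) (L v))); last by rewrite distC; apply: Lq.
  by apply: mu_lip3 => //; rewrite distxx.
have key t : t \in B -> restr V (majf x t y) = restr V t -> d (L t) (L x) <= r.
  move=> tB xty; have xtyB : majf x t y \in B by apply: Bc.
  apply: (dist_trans (y := L (majf x t y))); first exact: Lc.
  apply: (dist_trans (y := mu (L x) (L t) (L y))); first exact: Lq.
  rewrite -[X in d _ X](_ : mu (L x) (L t) (L x) = L x); last by rewrite m23 mid.
  by apply: mu_lip3 => //; rewrite distxx.
have -> : 2 * r = r + r by ring.
apply: (dist_trans (y := L x)); last rewrite distC; apply: key => //; apply/restr_eqP => w wV;
  have := fg w; rewrite !inE wV !ffunE /maj /=;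
  by case: (u w) (v w) (f w) (g w) => [] [] [] [] //= /(_ isT).
Qed.

(** Induction on the number of coordinates: [u] and [v] differ somewhere on [V], so each step
    removes at least one. On the empty set no cube exists. *)
Lemma collapse (H : R) (N : nat) : 0 <= H -> forall D, 0 <= D -> exists2 D', 0 <= D' &
  forall (W : finType) (B : {set {ffun W -> bool}}) L (V : {set W}),
    (#|V| <= N)%N -> quasi_hom B L H -> close_on B L V D -> maj_closed B ->
    exists V' : {set W}, close_on B L V' D' /\
      ~ exists z : {ffun 'I_n.+1 -> bool} -> _, cube_on B V' z.
Proof.
move=> H_ge0; elim: N => [|N IH] D D_ge0; have [c c_ge0 cP] := short_edge H_ge0 D_ge0.
  exists D => // W B L V; rewrite leqn0 cards_eq0 => /eqP V0 Lq Lc Bc.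
  exists V; split=> // -[z /(cP _ _ _ _ _ Lq Lc Bc)[u [v [_ _ []]]]].
  by apply/restr_eqP => w; rewrite V0 inE.
have D1_ge0 : 0 <= collapse_err H D c by rewrite mulr_ge0 // !(addr_ge0, mulr_ge0).
have [D' D'_ge0 D'P] := IH _ D1_ge0.
(* The sum covers both cases: [D] if there is no cube, [D'] after a removal. *)
exists (D + D') => [|W B L V VN Lq Lc Bc]; first exact: addr_ge0.
have [[z zc]|nz] := pselect (exists z : {ffun 'I_n.+1 -> bool} -> _, cube_on B V z); last first.
  exists V; split=> // f g fB gB fg; apply: le_trans (Lc f g fB gB fg) _.
  by rewrite lerDl.
have [u [v [uB vB uv uvc]]] := cP _ _ _ _ _ Lq Lc Bc zc.
have [||V' [V'c V'z]] := D'P W B L [set w in V | u w == v w] _ Lq _ Bc.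
- rewrite -ltnS; apply: leq_trans VN; apply: proper_card; rewrite properE.
  apply/andP; split; first by apply/fintype.subsetP => w; rewrite inE => /andP[].
  apply/negP => /fintype.subsetP sV; apply: uv; apply/restr_eqP => w /sV.
  by rewrite inE => /andP[_ /eqP].
- exact: collapse_edge.
exists V'; split=> // f g fB gB fg; apply: le_trans (V'c f g fB gB fg) _.
by rewrite lerDr.
Qed.

Lemma finite_approximation k : (0 < k)%N -> exists2 D, 0 <= D &
  forall a : 'I_k -> X, approximates d mu n D a.
Proof.
move=> k_gt0; have [B [L [D [D_ge0 Bc Bi Li Lm]]]] := free_median k_gt0.
(* Initially all coordinates are kept and the closeness error is 0. The final [V] depends on [a],
   the bound [D'] does not. *)
have [D' D'_ge0 D'P] := @collapse D #|{: {ffun 'I_k -> bool}}| D_ge0 0 (lexx 0).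
exists (D' + D) => [|a]; first exact: addr_ge0.
have [|||V [Vc /(restr_algebra Bc)[P [m [lift [mm mr liftB liftm liftP]]]]]] :=
  D'P _ B (fun f => L f a) [set: _]%SET _ _ _ Bc; first by rewrite cardsT.
- by move=> f g h fB gB hB; apply: Lm.
- move=> f g fB gB /restr_eqP fg.
  by rewrite (_ : f = g) ?distxx //; apply/ffunP => w; rewrite fg ?inE.
have [pi piP] := choice (fun i => liftP _ (Bi i)).
exists P, m; split=> //; split=> //; exists pi, (fun p => L (lift p) a).
split=> [x y z|i]; rewrite /simr.
  apply: dist_trans (Lm _ _ _ (liftB x) (liftB y) (liftB z) a).
  exact/Vc/liftm/Bc.
exact: dist_trans (Vc _ _ (liftB _) (Bi i) (piP i)) (Li i a).
Qed.

End Backward.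
End Affine.
End Coarse.

Theorem theorem4p12 (R : realType) (X : Type) (d : X -> X -> R)
    (mu : X -> X -> X -> X) (n : nat) :
  is_metric d ->
  (coarse_median_rank_le d mu n <->
   [/\ (* (M1) *) (forall a b, mu a a b = a),
       (* (M2) *) sym3 mu,
       (* (C1)' *)
       (exists K H0 : R, [/\ 0 <= K, 0 <= H0 &
          forall a a' b c, d (mu a b c) (mu a' b c) <= K * d a a' + H0]),
       (* (C2)' *)
       (exists kappa4 : R, 0 < kappa4 /\
          forall a b c e, simr d kappa4 (mu (mu a b c) b e) (mu a b (mu c b e)))
     & (* (C3)' *)
       (forall lambda : R, 0 < lambda -> exists C : R,
          forall (a b : X) (e : 'I_n.+1 -> X),
            (forall i, in_interval mu a b (e i)) ->
            (forall i j, i != j -> simr d lambda (mu (e i) a (e j)) a) ->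
            exists i, simr d C (e i) a)]).
Proof.
move=> dmet; split=> [[_ [mid [msym [K [H0 [Hp [Hp_ge0 [lip approx]]]]]]]]|].
  have [m12 m23] := (sym3P mu).1 msym.
  (* Absolute values are taken because (C1) does not fix the signs of [K] and [H0]. *)
  have lip1 a a' b c : d (mu a b c) (mu a' b c) <= `|K| * d a a' + `|H0|.
    apply: le_trans (lip _ _ _ _ _ _) _; rewrite !(distxx dmet) !addr0.
    by rewrite lerD ?ler_norm // ler_wpM2r ?ler_norm // (dist_ge0 dmet).
  have K_ge0 := normr_ge0 K; have H0_ge0 := normr_ge0 H0.
  have [kappa [kappa_gt0 kappaP]] := four_point dmet K_ge0 H0_ge0 m12 m23 lip1 Hp_ge0 approx.
  split=> //; first by exists `|K|, `|H0|.
    by exists kappa.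
  by move=> lambda _; apply: (corner_bound dmet K_ge0 mid m12 m23 lip1 approx kappaP).
move=> [mid msym [K [H0 [K_ge0 H0_ge0 lip1]]] [kappa [kappa_gt0 kappaP]] corner].
have [m12 m23] := (sym3P mu).1 msym.
split=> //; split=> //; split=> //.
have [|D DP] := @choice nat R (fun k D => 0 <= D /\ ((0 < k)%N ->
    forall a : 'I_k -> X, approximates d mu n D a)).
  move=> [|k]; first by exists 0.
  have [D D_ge0 DP] :=
    finite_approximation dmet K_ge0 H0_ge0 mid m12 m23 lip1 kappaP corner (ltn0Sn k).
  by exists D.
(* Summing over all sizes up to [p] gives one bound for every set of at most [p] points; size 0 gets
   a dummy value. *)
exists K, (H0 + H0 + H0), (fun p => \sum_(k < p.+1) D k); split; last split.
- by move=> p; apply: sumr_ge0 => k _; case: (DP k).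
- by move=> a b c a' b' c'; apply: (mu_lip3 dmet K_ge0 m12 m23 lip1).
move=> p k a _ /andP[k_gt0 kp].
have Dk : D k <= \sum_(k < p.+1) D k.
  have kp' : (k < p.+1)%N by [].
  rewrite (bigD1 (Ordinal kp')) //= lerDl.
  by apply: sumr_ge0 => i _; case: (DP i).
have [P [m [mm [mr [pi [lam [lm lp]]]]]]] := (DP k).2 k_gt0 a.
exists P, m; split=> //; split=> //; exists pi, lam.
by split=> *; apply: le_trans Dk; [apply: lm|apply: lp].
Qed.
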